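(* Let $n\ge 1$ and let $b=(b_1,\dots,b_n)$ be a sequence of positive integers. The $\mathbb{C}$-linear extension of $$A(b)\ni t^\pi\longmapsto t^{(\varphi(\pi),\,\deg\pi)}\in E(b),\qquad \pi\in\Pi(b),$$ is an isomorphism of graded algebras from the semigroup algebra $A(b)$ of L-S paths to the Ehrhart ring $E(b)$ of the lecture hall polytope $P(b)$.
   Context: For $b=(b_1,\dots,b_n)$ set $b_0=b_{n+1}:=1$. Let $e_1,\dots,e_{n+1}$ be the canonical basis of $\mathbb{R}^{n+1}$ and let $L(b)\subset\mathbb{R}^{n+1}$ be the lattice generated by $v_j:=\frac{e_j-e_{j+1}}{b_j}$ for $j=1,\dots,n$ and $v_{n+1}:=e_{n+1}$. The monoid of L-S paths with bonds $b$ is $\Pi(b):=L(b)\cap\mathbb{R}^{n+1}_{\ge 0}$. The degree of $\pi=(a_1,\dots,a_{n+1})\in\Pi(b)$ is $\deg(\pi):=a_1+\cdots+a_{n+1}$, a non-negative integer, and $\Pi(b)_k$ is the set of L-S paths of degree $k$. For $k=1,\dots,n+1$ let $N_k:=\mathrm{lcm}(b_k,b_{k-1})$, and let $R:=\mathbb{C}[t_1^{1/N_1},\dots,t_{n+1}^{1/N_{n+1}}]$ be the polynomial algebra in the indeterminates $t_k^{1/N_k}$. For $\pi=(a_1,\dots,a_{n+1})\in\Pi(b)$ one has $N_ka_k\in\mathbb{Z}_{\ge0}$ for all $k$, and $t^\pi:=t_1^{a_1}\cdots t_{n+1}^{a_{n+1}}\in R$. The semigroup algebra is $A(b):=\bigoplus_{\pi\in\Pi(b)}\mathbb{C}\,t^\pi\subseteq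 R$, with multiplication $t^\pi\cdot t^\eta=t^{\pi+\eta}$, graded by $A(b)_k:=\langle t^\pi\mid\pi\in\Pi(b)_k\rangle_{\mathbb{C}}$. The lecture hall polytope is $P(b):=\{(x_1,\dots,x_n)\in\mathbb{R}^n : 0\le\frac{x_1}{b_1}\le\cdots\le\frac{x_n}{b_n}\le 1\}$. For $p=(p_1,\dots,p_n)\in kP(b)\cap\mathbb{Z}^n$, $k\in\mathbb{Z}_{\ge 0}$, put $t^{(p,k)}:=t_1^{p_1}\cdots t_n^{p_n}t_{n+1}^k$. The Ehrhart ring of $P(b)$ is the graded algebra $E(b):=\bigoplus_{k\ge 0}E(b)_k$, $E(b)_k:=\langle t^{(p,k)}\mid p\in kP(b)\cap\mathbb{Z}^n\rangle_{\mathbb{C}}$, with multiplication $t^{(p,k)}\cdot t^{(q,h)}=t^{(p+q,k+h)}$. The map $\varphi:\mathbb{R}^{n+1}\to\mathbb{R}^n$ is the linear map $(a_1,\dots,a_{n+1})\mapsto(x_1,\dots,x_n)$ with $x_i=b_i(a_1+\cdots+a_i)$. *)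

(* Defs.v *)
From HB Require Import structures.
From mathcomp Require Import all_boot all_order all_algebra.
From mathcomp Require Import complex mpoly.
From mathcomp Require Import boolp reals.

Set Implicit Arguments.
Unset Strict Implicit.
Unset Printing Implicit Defensive.

Import Order.TTheory GRing.Theory Num.Theory.
Local Open Scope ring_scope.

(* The index k : 'I_n.+1 is 0-based: it stands for the position k.+1 of the
   usual 1-based numbering; likewise for 'I_n. *)

Section LinearSpan.
Variables (K : pzRingType) (V : lmodType K).

Definition lspan (G : V -> Prop) (v : V) : Prop :=
  exists m (c : 'I_m -> K) (g : 'I_m -> V),
    (forall i, G (g i)) /\ v = \sum_(i < m) c i *: g i.

Lemma lspan_gen (G : V -> Prop) v : G v -> lspan G v.
Proof.
move=> Gv; exists 1%N, (fun=> 1), (fun=> v); split=> //.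
by rewrite big_ord_recl big_ord0 scale1r addr0.
Qed.

Lemma lspan0 (G : V -> Prop) : lspan G 0.
Proof.
by exists 0%N, (fun=> 0), (fun=> 0); split=> [[]|] //; rewrite big_ord0.
Qed.

Lemma lspanD (G : V -> Prop) u v : lspan G u -> lspan G v -> lspan G (u + v).
Proof.
move=> [m [c [g [Gg ->]]]] [m' [c' [g' [Gg' ->]]]].
exists (m + m')%N.
exists (fun i => match split i with inl j => c j | inr j => c' j end).
exists (fun i => match split i with inl j => g j | inr j => g' j end).
split=> [i|]; first by case: split.
rewrite big_split_ord /=; congr (_ + _); apply: eq_bigr => i _.
  by rewrite (unsplitK (inl i)).
by rewrite (unsplitK (inr i)).
Qed.

Lemma lspanZ (G : V -> Prop) a v : lspan G v -> lspan G (a *: v).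
Proof.
move=> [m [c [g [Gg ->]]]]; exists m, (fun i => a * c i), g; split=> //.
by rewrite scaler_sumr; apply: eq_bigr => i _; rewrite scalerA.
Qed.

Lemma lspan_sum (G : V -> Prop) m (f : 'I_m -> V) :
  (forall i, lspan G (f i)) -> lspan G (\sum_(i < m) f i).
Proof.
by move=> Gf; apply: big_ind => //; [exact: lspan0 | exact: lspanD].
Qed.

End LinearSpan.

Lemma lspan_subalg (K : comNzRingType) (A : algType K) (G : A -> Prop) :
  G 1 -> (forall x y, G x -> G y -> G (x * y)) ->
  subalg_closed [pred x : A | `[< lspan G x >]].
Proof.
move=> G1 GM; split=> [|a u v|u v].
- by apply/asboolP; exact: lspan_gen.
- move=> /asboolP Gu /asboolP Gv; apply/asboolP.
  by apply: lspanD => //; exact: lspanZ.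
- move=> /asboolP[m [c [g [Gg ->]]]] /asboolP[m' [c' [g' [Gg' ->]]]].
  apply/asboolP; rewrite mulr_suml; apply: lspan_sum => i.
  rewrite mulr_sumr; apply: lspan_sum => j.
  rewrite -scalerAl -scalerAr; do 2!apply: lspanZ.
  by apply: lspan_gen; exact: GM.
Qed.

Record bonds (n : nat) := Bonds {
  bond :> 'I_n -> nat;
  bond_gt0 : forall i, (0 < bond i)%N }.

Section LSPaths.
Variables (R : realType) (n : nat) (b : bonds n).
Implicit Types (a : 'rV[R]_n.+1).

(* b_k for k = 0, ..., n+1, with b_0 = b_(n+1) = 1 *)
Definition bond_ext (k : nat) : nat :=
  if k is j.+1 then
    if insub j is Some i then b i else 1%N
  else 1%N.

(* [lift ord_max i] and [lift ord0 i] are the elements i and i.+1 of 'I_n.+1 *)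
Definition lattice_gen (j : 'I_n.+1) : 'rV[R]_n.+1 :=
  if unlift ord_max j is Some i then
    (b i)%:R^-1 *: (delta_mx 0 (lift ord_max i) - delta_mx 0 (lift ord0 i))
  else delta_mx 0 ord_max.

Definition in_lattice a : Prop :=
  exists c : 'I_n.+1 -> int, a = \sum_j lattice_gen j *~ c j.

Definition is_LSpath a : Prop :=
  in_lattice a /\ forall k, 0 <= a 0 k.

Definition LSdeg a : R := \sum_k a 0 k.

Definition bond_lcm (k : 'I_n.+1) : nat := lcmn (bond_ext k.+1) (bond_ext k).

(* The variable 'X_k of {mpoly R[i][n.+1]} plays the role of t_k^(1/N_k), so
   that t_k^(a_k) is 'X_k ^+ (N_k a_k); N_k a_k is a natural number whenever
   a is an L-S path, see [LSpath_nat]. *)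
Definition LSmonomial a : {mpoly R[i][n.+1]} :=
  \prod_(k < n.+1) 'X_k ^+ Num.truncn ((bond_lcm k)%:R * a 0 k).

Lemma bond_ext_lift0 (i : 'I_n) : bond_ext (lift ord0 i) = b i.
Proof. by rewrite /bond_ext lift0 valK. Qed.

Lemma bond_ext_liftS (i : 'I_n) : bond_ext (lift ord_max i).+1 = b i.
Proof. by rewrite /bond_ext lift_max valK. Qed.

Lemma LSpath_nat a k :
  is_LSpath a -> (bond_lcm k)%:R * a 0 k \is a Num.nat.
Proof.
move=> [[c ->] a_ge0]; rewrite natrEint mulr_ge0 ?ler0n // andbT.
rewrite summxE mulr_sumr; apply: rpred_sum => j _.
rewrite -scaler_int mxE mulrCA rpredM ?intr_int //.
rewrite /lattice_gen; case: unliftP => [i|] _; last first.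
  by rewrite mxE rpredM ?intr_nat ?natr_nat.
have intd (m d : nat) : (d %| m)%N -> (m%:R * d%:R^-1 : R) \is a Num.int.
  by move=> dm; rewrite -natf_div // intr_nat ?natr_nat.
rewrite !mxE mulrA mulrBr /= rpredB //.
- have [->|_] := eqVneq k; last by rewrite mulr0 rpred0.
  by rewrite mulr1 intd // -bond_ext_liftS dvdn_lcml.
- have [->|_] := eqVneq k; last by rewrite mulr0 rpred0.
  by rewrite mulr1 intd // -bond_ext_lift0 dvdn_lcmr.
Qed.

Lemma is_LSpath0 : is_LSpath 0.
Proof.
split=> [|k]; last by rewrite mxE.
by exists (fun=> 0); rewrite big1.
Qed.

Lemma is_LSpathD a a' : is_LSpath a -> is_LSpath a' -> is_LSpath (a + a').
Proof.
move=> [[c ->] ge0] [[c' ->] ge0']; split=> [|k].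
  exists (fun j => c j + c' j); rewrite -big_split /=.
  by apply: eq_bigr => j _; rewrite mulrzDr.
by rewrite mxE addr_ge0.
Qed.

Lemma LSmonomial0 : LSmonomial 0 = 1.
Proof. by rewrite /LSmonomial big1 // => k _; rewrite mxE mulr0 truncn0. Qed.

Lemma LSmonomialD a a' : is_LSpath a -> is_LSpath a' ->
  LSmonomial (a + a') = LSmonomial a * LSmonomial a'.
Proof.
move=> Pa Pa'; rewrite /LSmonomial -big_split /=; apply: eq_bigr => k _.
rewrite mxE mulrDr truncnD ?exprD ?LSpath_nat //.
by rewrite qualifE /= mulr_ge0 ?ler0n //; case: Pa'.
Qed.

Definition LSmonomials (p : {mpoly R[i][n.+1]}) : Prop :=
  exists2 a, is_LSpath a & p = LSmonomial a.

Definition LSalg_pred : pred {mpoly R[i][n.+1]} :=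
  [pred p | `[< lspan LSmonomials p >]].

Lemma LSalg_subproof : subalg_closed LSalg_pred.
Proof.
apply: lspan_subalg => [|_ _ [a Pa ->] [a' Pa' ->]].
  by exists 0; [exact: is_LSpath0 | rewrite LSmonomial0].
by exists (a + a'); [exact: is_LSpathD | rewrite LSmonomialD].
Qed.

HB.instance Definition _ := GRing.isSubalgClosed.Build R[i]
  {mpoly R[i][n.+1]} LSalg_pred LSalg_subproof.

Record LSalg := LSAlg {
  LSalg_val : {mpoly R[i][n.+1]};
  LSalg_valP : LSalg_val \in LSalg_pred }.

HB.instance Definition _ := [isSub for LSalg_val].
HB.instance Definition _ := [Choice of LSalg by <:].
HB.instance Definition _ := [SubChoice_isSubAlgebra of LSalg by <:].
HB.instance Definition _ :=
  [SubNzRing_isSubComNzRing of LSalg by <:].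

Lemma LSmonomial_in a : is_LSpath a -> LSmonomial a \in LSalg_pred.
Proof. by move=> Pa; apply/asboolP/lspan_gen; exists a. Qed.

Definition LSalg_mon a (Pa : is_LSpath a) : LSalg := LSAlg (LSmonomial_in Pa).

Definition LSalg_homog (k : nat) (x : LSalg) : Prop :=
  lspan (fun p => exists a,
    [/\ is_LSpath a, LSdeg a = k%:R & p = LSmonomial a]) (LSalg_val x).

End LSPaths.

Section LectureHall.
Variables (R : realType) (n : nat) (b : bonds n).
Implicit Types (x : 'rV[R]_n) (p q : 'rV[int]_n) (k : nat).

Definition lecture_hall x : Prop :=
  [/\ forall i, 0 <= x 0 i / (b i)%:R,
      forall i j : 'I_n, (i <= j)%N -> x 0 i / (b i)%:R <= x 0 j / (b j)%:R
    & forall i, x 0 i / (b i)%:R <= 1].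

Definition in_dilate k p : Prop :=
  exists2 x, lecture_hall x & map_mx intr p = k%:R *: x.

(* The p_i are non-negative for p in kP(b), see [in_dilate_ge0]. *)
Definition Emonomial p k : {mpoly R[i][n.+1]} :=
  (\prod_(i < n) 'X_(lift ord_max i) ^+ absz (p 0 i)) * 'X_ord_max ^+ k.

Lemma in_dilate_ge0 k p i : in_dilate k p -> 0 <= p 0 i.
Proof.
move=> [x [x_ge0 _ _] /rowP/(_ i)]; rewrite !mxE => pE.
rewrite -(ler0z R) pE mulr_ge0 ?ler0n //.
by have := x_ge0 i; rewrite pmulr_lge0 // invr_gt0 ltr0n bond_gt0.
Qed.

Lemma in_dilate0 : in_dilate 0 0.
Proof.
exists 0; last by rewrite scale0r map_mx0.
by split=> [i|i j _|i]; rewrite !mxE !mul0r.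
Qed.

Lemma in_dilateD k h p q :
  in_dilate k p -> in_dilate h q -> in_dilate (k + h) (p + q).
Proof.
move=> [x Px pE] [y Py qE]; have [/eqP|kh_neq0] := eqVneq (k + h)%N 0%N.
  rewrite addn_eq0 => /andP[/eqP k0 /eqP h0]; exists x => //.
  by rewrite map_mxD pE qE k0 h0 !scale0r addr0.
have kh_gt0 : 0 < (k + h)%:R :> R by rewrite ltr0n lt0n.
pose s : R := (k + h)%:R^-1 * k%:R; pose t : R := (k + h)%:R^-1 * h%:R.
have s0 : 0 <= s by rewrite mulr_ge0 ?invr_ge0 ?ler0n.
have t0 : 0 <= t by rewrite mulr_ge0 ?invr_ge0 ?ler0n.
have st : s + t = 1 by rewrite -mulrDr -natrD mulVf ?gt_eqF.
have E i : (s *: x + t *: y) 0 i / (b i)%:R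
    = s * (x 0 i / (b i)%:R) + t * (y 0 i / (b i)%:R).
  by rewrite !mxE mulrDl !mulrA.
case: Px Py => [x0 xm x1] [y0 ym y1].
exists (s *: x + t *: y); first split=> [i|i j ij|i]; rewrite ?E.
- by rewrite addr_ge0 // mulr_ge0.
- by rewrite lerD ?ler_wpM2l ?xm ?ym.
- by rewrite -[leRHS]st lerD ?ler_piMr.
- rewrite map_mxD pE qE scalerDr !scalerA !mulrA divff ?gt_eqF //.
  by rewrite !mul1r.
Qed.

Lemma Emonomial0 : Emonomial 0 0 = 1.
Proof.
by rewrite /Emonomial expr0 mulr1 big1 // => i _; rewrite mxE.
Qed.

Lemma EmonomialD k h p q : in_dilate k p -> in_dilate h q ->
  Emonomial (p + q) (k + h) = Emonomial p k * Emonomial q h.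
Proof.
move=> Pp Pq; rewrite /Emonomial mulrACA -big_split exprD /=.
congr (_ * _); apply: eq_bigr => i _; rewrite mxE -exprD; congr (_ ^+ _).
move: (in_dilate_ge0 i Pp) (in_dilate_ge0 i Pq).
by case: (p 0 i) => // ?; case: (q 0 i).
Qed.

Definition Emonomials (u : {mpoly R[i][n.+1]}) : Prop :=
  exists p k, in_dilate k p /\ u = Emonomial p k.

Definition Ehrhart_pred : pred {mpoly R[i][n.+1]} :=
  [pred u | `[< lspan Emonomials u >]].

Lemma Ehrhart_subproof : subalg_closed Ehrhart_pred.
Proof.
apply: lspan_subalg => [|_ _ [p [k [Pp ->]]] [q [h [Pq ->]]]].
  by exists 0, 0%N; split; [exact: in_dilate0 | rewrite Emonomial0].
by exists (p + q), (k + h)%N; split; [exact: in_dilateD|rewrite EmonomialD].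
Qed.

HB.instance Definition _ := GRing.isSubalgClosed.Build R[i]
  {mpoly R[i][n.+1]} Ehrhart_pred Ehrhart_subproof.

Record Ehrhart := MkEhrhart {
  Ehrhart_val : {mpoly R[i][n.+1]};
  Ehrhart_valP : Ehrhart_val \in Ehrhart_pred }.

HB.instance Definition _ := [isSub for Ehrhart_val].
HB.instance Definition _ := [Choice of Ehrhart by <:].
HB.instance Definition _ := [SubChoice_isSubAlgebra of Ehrhart by <:].
HB.instance Definition _ :=
  [SubNzRing_isSubComNzRing of Ehrhart by <:].

Lemma Emonomial_in k p : in_dilate k p -> Emonomial p k \in Ehrhart_pred.
Proof. by move=> Pp; apply/asboolP/lspan_gen; exists p, k. Qed.

Definition Ehrhart_mon k p (Pp : in_dilate k p) : Ehrhart :=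
  MkEhrhart (Emonomial_in Pp).

Definition Ehrhart_homog k (x : Ehrhart) : Prop :=
  lspan (fun u => exists2 p, in_dilate k p & u = Emonomial p k)
    (Ehrhart_val x).

End LectureHall.

Section Comparison.
Variables (R : realType) (n : nat) (b : bonds n).

Definition phi (a : 'rV[R]_n.+1) : 'rV[R]_n :=
  \row_i ((b i)%:R * \sum_(j < n.+1 | (j <= i)%N) a 0 j).

(* f (t^a) = t^(phi a, deg a) for every L-S path a; it is part of the
   condition that (phi a, deg a) is a pair (p, k) with p an integer point
   of kP(b), so that the right-hand side is an element of E(b). *)
Definition extends_phi (f : LSalg R b -> Ehrhart R b) : Prop :=
  forall a (Pa : is_LSpath b a),
  exists p k (Pp : in_dilate R b k p),
    [/\ phi a = map_mx intr p, LSdeg a = k%:R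
      & f (LSalg_mon Pa) = Ehrhart_mon Pp].

Definition graded_alg_iso (f : {linear LSalg R b -> Ehrhart R b}) : Prop :=
  [/\ monoid_morphism f, bijective f
    & forall k x, LSalg_homog k x <-> Ehrhart_homog k (f x)].

End Comparison.

(* Main.v *)
Require Import Defs.
From HB Require Import structures.
From mathcomp Require Import all_boot all_order all_algebra.
From mathcomp Require Import complex ssrcomplements mpoly.
From mathcomp Require Import boolp reals.

(* Taking partial sums a_1 + ... + a_k sends the generator v_j of L(b) to 1/b_j
   in position j, so (phi, deg) maps the lattice basis (v_j) to the standard
   basis of Z^(n+1).  A vector is non-negative exactly when its partial sums
   are non-negative and increasing, which is the lecture hall condition for
   (phi a, deg a).  Hence a |-> (phi a, deg a) is an isomorphism of graded
   monoids from Pi(b) to the pairs (p, k) with p an integer point of k P(b);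
   since distinct elements have distinct monomials, it extends linearly to an
   isomorphism of the semigroup algebras. *)

Set Implicit Arguments.
Unset Strict Implicit.
Unset Printing Implicit Defensive.

Import Order.TTheory GRing.Theory Num.Theory.
Local Open Scope ring_scope.

(** * Linear maps prescribed on spanning sets and on monomials *)

Section LinearExtension.
Variables (K : pzRingType) (V W : lmodType K).

Lemma lspan_map (F : {linear V -> W}) (G : V -> Prop) (H : W -> Prop) v :
  (forall u, G u -> H (F u)) -> lspan G v -> lspan H (F v).
Proof.
move=> FGH [m [c [g [Gg ->]]]]; exists m, c, (fun i => F (g i)).
split=> [i|]; first exact: FGH.
by rewrite linear_sum; apply: eq_bigr => i _; rewrite linearZ.
Qed.

Lemma eq_linear_lspan (F F' : {linear V -> W}) (G : V -> Prop) v :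
  (forall u, G u -> F u = F' u) -> lspan G v -> F v = F' v.
Proof.
move=> eqFF' [m [c [g [Gg ->]]]]; rewrite !linear_sum.
by apply: eq_bigr => i _; rewrite !linearZ eqFF'.
Qed.

End LinearExtension.

(** The monomials form a basis, so their images can be chosen freely. *)
Lemma mpoly_linear_extension (K : nzRingType) (n : nat) (W : lmodType K)
    (h : 'X_{1..n} -> W) :
  exists F : {linear {mpoly K[n]} -> W}, forall m, F 'X_[m] = h m.
Proof.
pose F (p : {mpoly K[n]}) := \sum_(m <- msupp p) p@_m *: h m.
have FE p i : (msize p <= i)%N ->
    F p = \sum_(m : 'X_{1..n < i}) p@_m *: h m.
  move=> le_pi; rewrite /F (big_mksub 'X_{1..n < i}) ?msupp_uniq //=.
    rewrite big_rmcond //= => j /memN_msupp_eq0 ->.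
    by rewrite scale0r.
  by move=> x /msize_mdeg_lt /leq_trans; apply.
have F_linear : linear F.
  (* The three supports may differ, so all sums are taken over one finite index set, with [i]
     bounding the three sizes. *)
  move=> a p q; pose i := maxn (msize (a *: p + q)) (maxn (msize p) (msize q)).
  rewrite !(FE _ i) ?leq_max ?leqnn ?orbT // scaler_sumr -big_split /=.
  by apply: eq_bigr => m _; rewrite mcoeffD mcoeffZ scalerDl scalerA.
pose F' : {linear {mpoly K[n]} -> W} :=
  HB.pack F (GRing.isLinear.Build K {mpoly K[n]} W *:%R F F_linear).
exists F' => m; rewrite /= /F msuppX big_seq1 mcoeffX eqxx.
by rewrite scale1r.
Qed.

(** Serves when values are prescribed on some monomials only; the remaining ones are sent to 0. *)
Lemma mpoly_linear_relation (K : nzRingType) (n : nat) (W : lmodType K)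
    (P : 'X_{1..n} -> W -> Prop) :
  (forall m v v', P m v -> P m v' -> v = v') ->
  exists F : {linear {mpoly K[n]} -> W}, forall m v, P m v -> F 'X_[m] = v.
Proof.
move=> P_fun; pose Q m w := forall v, P m v -> w = v.
have [m|h Qh] := @choice _ _ Q.
  have [[w Pw]|noP] := pselect (exists w, P m w).
    by exists w => v; exact: P_fun.
  by exists 0 => v Pv; case: noP; exists v.
have [F FX] := mpoly_linear_extension h.
by exists F => m v Pv; rewrite FX; exact: Qh.
Qed.

(** * Partial sums of the coordinates *)

Section PartialSums.
Variables (R : realType) (n : nat) (b : bonds n).
Implicit Types (a : 'rV[R]_n.+1) (p : 'rV[int]_n) (k : nat).

(** With 0-based indices the strict bound gives a_1 + ... + a_k in 1-based notation. *)
Definition psum a k : R := \sum_(j < n.+1 | (j < k)%N) a 0 j.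

Lemma psum0 a : psum a 0 = 0. Proof. by rewrite /psum big_pred0. Qed.

Lemma psumS a (j : 'I_n.+1) : psum a j.+1 = psum a j + a 0 j.
Proof.
rewrite /psum (bigD1 j) ?ltnSn //= addrC; congr (_ + _).
by apply: eq_bigl => i; rewrite ltnS [RHS]ltn_neqAle andbC.
Qed.

Lemma psum_full a : psum a n.+1 = LSdeg a.
Proof. by apply: eq_bigl => i; rewrite ltn_ord. Qed.

Lemma phiE a i : phi b a 0 i = (b i)%:R * psum a i.+1.
Proof. by rewrite mxE. Qed.

Lemma bond_neq0 i : (b i)%:R != 0 :> R.
Proof. by rewrite pnatr_eq0 -lt0n bond_gt0. Qed.

Lemma psum_phi a (i : 'I_n) : psum a i.+1 = phi b a 0 i / (b i)%:R.
Proof. by rewrite phiE mulrC mulKf ?bond_neq0. Qed.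

Lemma psum_monotone a k l :
  (forall j, 0 <= a 0 j) -> (k <= l)%N -> psum a k <= psum a l.
Proof.
move=> a_ge0 kl; rewrite /psum big_mkcond [leRHS]big_mkcond /=.
apply: ler_sum => j _; case: ifP => [jk|_]; last by case: ifP.
by rewrite (leq_trans jk kl).
Qed.

(** As the bonds are nonzero, [phi] fixes the partial sums of index 1 to n, and the degree fixes the
    last one; the coordinates are their successive differences. *)
Lemma phi_LSdeg_inj a a' : phi b a = phi b a' -> LSdeg a = LSdeg a' -> a = a'.
Proof.
move=> eq_phi eq_deg.
have eqS k : (k <= n.+1)%N -> psum a k = psum a' k.
  case: k => [|k]; first by rewrite !psum0.
  rewrite ltnS leq_eqVlt => /orP[/eqP->|lt_kn]; first by rewrite !psum_full.
  by rewrite (psum_phi _ (Ordinal lt_kn)) eq_phi -psum_phi.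
apply/rowP => j; have := eqS j.+1 (ltn_ord j).
by rewrite !psumS (eqS j) ?(ltnW (ltn_ord j)) // => /addrI.
Qed.

Lemma psum_delta (j : 'I_n.+1) k : psum (delta_mx 0 j) k = (j < k)%:R.
Proof.
rewrite /psum big_mkcond (bigD1 j) //= big1 ?addr0 => [|i ij].
  by rewrite mxE !eqxx; case: ifP.
by rewrite mxE (negPf ij) andbF if_same.
Qed.

(** * Lattice points in terms of partial sums *)

Definition lattice_point (c : 'I_n.+1 -> int) : 'rV[R]_n.+1 :=
  \sum_j lattice_gen R b j *~ c j.

(** The partial sums of e_j - e_(j+1) telescope, so only the j-th one survives; here j is [i.+1]. *)
Lemma psum_lattice_gen (j : 'I_n.+1) k : psum (lattice_gen R b j) k =
  if unlift ord_max j is Some i then (k == i.+1)%:R / (b i)%:R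
  else (n < k)%:R.
Proof.
rewrite /lattice_gen; case: unliftP => [i|] _; last exact: psum_delta.
have -> : psum ((b i)%:R^-1 *: (delta_mx 0 (lift ord_max i) -
    delta_mx 0 (lift ord0 i))) k = (b i)%:R^-1 *
    (psum (delta_mx 0 (lift ord_max i)) k - psum (delta_mx 0 (lift ord0 i)) k).
  by rewrite /psum -sumrB mulr_sumr; apply: eq_bigr => l _; rewrite !mxE.
rewrite !psum_delta lift_max lift0 mulrC; congr (_ * _).
by case: (ltngtP i.+1 k) => _; rewrite ?mulr0n ?subrr ?subr0.
Qed.

Lemma psum_lattice_point c k : psum (lattice_point c) k =
  \sum_(i < n) (k == i.+1)%:R / (b i)%:R * (c (lift ord_max i))%:~R
  + (n < k)%:R * (c ord_max)%:~R.
Proof.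
have -> : psum (lattice_point c) k =
    \sum_j psum (lattice_gen R b j) k * (c j)%:~R.
  rewrite /psum; under [RHS]eq_bigr do rewrite mulr_suml.
  rewrite exchange_big /=; apply: eq_bigr => l _.
  rewrite summxE; apply: eq_bigr => j _.
  by rewrite -scaler_int mxE mulrC.
rewrite big_ord_recr /=; congr (_ + _); last first.
  by rewrite psum_lattice_gen unlift_none.
apply: eq_bigr => i _.
have -> : widen_ord (leqnSn n) i = lift ord_max i.
  by apply/val_inj; exact/esym/lift_max.
by rewrite psum_lattice_gen liftK.
Qed.

(** The factor [b i] cancels the denominator of the generator, so [phi] reads off the first n
    coefficients; the degree reads off the last. *)
Lemma phi_lattice_point c i :
  phi b (lattice_point c) 0 i = (c (lift ord_max i))%:~R.
Proof.
rewrite phiE psum_lattice_point (bigD1 i) //= eqxx big1 => [|j ji].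
  (* The last generator enters only from index n+1 on, and the index here is at most n. *)
  by rewrite addr0 ltnS leqNgt ltn_ord mul0r addr0 mul1r mulVKf ?bond_neq0.
by rewrite eqSS eq_sym (negPf (ji : (j : nat) != i)) !mul0r.
Qed.

Lemma LSdeg_lattice_point c : LSdeg (lattice_point c) = (c ord_max)%:~R.
Proof.
rewrite -psum_full psum_lattice_point ltnSn mul1r big1 ?add0r // => i _.
by rewrite eqSS gtn_eqF // !mul0r.
Qed.

(** * The correspondence between L-S paths and lecture hall points *)

Lemma in_dilate_phi a p k : (forall j, 0 <= a 0 j) ->
  phi b a = map_mx intr p -> LSdeg a = k%:R -> in_dilate R b k p.
Proof.
move=> a_ge0 phi_a deg_a.
have psum_ge0 l : 0 <= psum a l by rewrite -(psum0 a) psum_monotone.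
have psum_le i : psum a (i : 'I_n).+1 <= k%:R.
  by rewrite -deg_a -psum_full psum_monotone // ltnS ltnW.
(* [k%:R^-1 = 0] when [k = 0], and then [map_mx intr p = 0] as well. *)
exists (k%:R^-1 *: map_mx intr p).
  have E i : (k%:R^-1 *: map_mx intr p : 'rV[R]_n) 0 i / (b i)%:R
      = k%:R^-1 * psum a i.+1.
    by rewrite mxE -phi_a -mulrA -psum_phi.
  split=> [i|i j ij|i]; rewrite !E.
  - by rewrite mulr_ge0 // invr_ge0 ler0n.
  - by rewrite ler_wpM2l ?invr_ge0 ?ler0n // psum_monotone.
  - have [->|k_neq0] := eqVneq k 0%N; first by rewrite invr0 mul0r ler01.
    by rewrite mulrC ler_pdivrMr ?mul1r // ltr0n lt0n.
have [k0|k_neq0] := eqVneq k 0%N; last first.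
  by rewrite scalerA divff ?scale1r // pnatr_eq0.
rewrite k0 scale0r -phi_a; apply/rowP => i; rewrite phiE mxE.
(* Degree 0 squeezes every partial sum between 0 and 0. *)
have /eqP -> : psum a i.+1 == 0; last by rewrite mulr0.
by rewrite eq_le psum_ge0 andbT (le_trans (psum_le i)) // k0.
Qed.

(** The graph of the correspondence. It is a relation because [p] and [k] are integral while [phi a]
    and [LSdeg a] are real-valued. *)
Definition LS_lecture_hall a p k : Prop :=
  [/\ is_LSpath b a, in_dilate R b k p, phi b a = map_mx intr p
    & LSdeg a = k%:R].

Lemma LSpath_lecture_hall a :
  is_LSpath b a -> exists p k, LS_lecture_hall a p k.
Proof.
move=> Pa; have [[c aE] a_ge0] := Pa.
pose p : 'rV[int]_n := \row_i c (lift ord_max i).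
have phi_a : phi b a = map_mx intr p.
  apply/rowP => i; rewrite [RHS]mxE [p 0 i]mxE aE.
  by rewrite -/(lattice_point c) phi_lattice_point.
have deg_a : LSdeg a = (absz (c ord_max))%:R.
  have := LSdeg_lattice_point c; rewrite /lattice_point -aE => deg_c.
  (* A non-negative degree is unchanged by [absz]. *)
  have : 0 <= LSdeg a by apply: sumr_ge0.
  by rewrite deg_c ler0z; case: (c ord_max).
by exists p, (absz (c ord_max)); split=> //; apply: in_dilate_phi phi_a _.
Qed.

Lemma lecture_hall_LSpath p k :
  in_dilate R b k p -> exists a, LS_lecture_hall a p k.
Proof.
move=> Pp; have [x [x_ge0 x_mono x_le1] pE] := Pp.
(* Since [phi] and the degree read off lattice coefficients, the preimage of [(p, k)] must have [p]
   and [k] as its coefficients. *)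
pose c j := if unlift ord_max j is Some i then p 0 i else k%:Z.
pose a := lattice_point c.
have phi_a : phi b a = map_mx intr p.
  by apply/rowP => i; rewrite phi_lattice_point /c liftK mxE.
have deg_a : LSdeg a = k%:R by rewrite LSdeg_lattice_point /c unlift_none.
have psum_x (i : 'I_n) : psum a i.+1 = k%:R * (x 0 i / (b i)%:R).
  by rewrite psum_phi phi_a pE mxE mulrA.
exists a; split=> //; split=> [|j]; first by exists c.
(* Each coordinate is an increment of the partial sums. For n > 0, the first is non-negative by
   [x_ge0], the middle ones by [x_mono], the last by [x_le1]; for n = 0 the only coordinate is
   [k]. *)
rewrite -(lerD2l (psum a j)) addr0 -psumS.
have [i ->|->] := unliftP ord_max j.
  rewrite lift_max psum_x; case def_i: (i : nat) => [|l].
    by rewrite psum0 mulr_ge0 ?ler0n.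
  have lt_ln : (l < n)%N by rewrite ltnW // -def_i.
  rewrite (psum_x (Ordinal lt_ln)) ler_wpM2l ?ler0n // x_mono //.
  by rewrite /= def_i.
rewrite psum_full deg_a /=; case def_n: {1}n => [|l].
  by rewrite psum0 ler0n.
have lt_ln : (l < n)%N by rewrite def_n.
by rewrite (psum_x (Ordinal lt_ln)) ler_piMr ?ler0n.
Qed.

Lemma LS_lecture_hall_functional a p k q h :
  LS_lecture_hall a p k -> LS_lecture_hall a q h -> p = q /\ k = h.
Proof.
move=> [_ _ phi_p deg_k] [_ _ phi_q deg_h]; split.
  apply/rowP => i; apply/(@intr_inj R).
  by move/rowP/(_ i): (etrans (esym phi_p) phi_q); rewrite !mxE.
by apply/eqP; rewrite -(eqr_nat R) -deg_k deg_h.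
Qed.

Lemma LS_lecture_hall_inj a a' p k :
  LS_lecture_hall a p k -> LS_lecture_hall a' p k -> a = a'.
Proof.
move=> [_ _ phi_a deg_a] [_ _ phi_a' deg_a'].
by apply: phi_LSdeg_inj; rewrite ?phi_a ?deg_a.
Qed.

Lemma LS_lecture_hallD a a' p q k h :
  LS_lecture_hall a p k -> LS_lecture_hall a' q h ->
  LS_lecture_hall (a + a') (p + q) (k + h).
Proof.
move=> [Pa Pp phi_a deg_a] [Pa' Pq phi_a' deg_a']; split.
- exact: is_LSpathD.
- exact: in_dilateD.
- rewrite map_mxD -phi_a -phi_a'; apply/rowP => i; rewrite !mxE -mulrDr.
  by congr (_ * _); rewrite -big_split; apply: eq_bigr => j _; rewrite mxE.
- rewrite natrD -deg_a -deg_a' /LSdeg -big_split.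
  by apply: eq_bigr => j _; rewrite mxE.
Qed.

Lemma LS_lecture_hall0 : LS_lecture_hall 0 0 0.
Proof.
split; [exact: is_LSpath0|exact: in_dilate0|rewrite map_mx0|].
  by apply/rowP => i; rewrite !mxE big1 ?mulr0 // => j _; rewrite mxE.
by apply: big1 => j _; rewrite mxE.
Qed.

(** * Exponent vectors of the two families of monomials *)

Definition LSmnm a : 'X_{1..n.+1} :=
  [multinom (Num.truncn ((bond_lcm b k)%:R * a 0 k))%R | k < n.+1].

Lemma LSmonomialE a : LSmonomial b a = 'X_[LSmnm a].
Proof. by rewrite mpolyXE_id; apply: eq_bigr => k _; rewrite mnmE. Qed.

(** Truncation loses nothing because N_k a_k is a natural number, and N_k can be cancelled because
    it is nonzero. *)
Lemma LSmnm_inj a a' :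
  is_LSpath b a -> is_LSpath b a' -> LSmnm a = LSmnm a' -> a = a'.
Proof.
move=> Pa Pa' eq_mnm; apply/rowP => k.
have bond_lcm_neq0 : (bond_lcm b k)%:R != 0 :> R.
  have ext_gt0 l : (0 < bond_ext b l)%N.
    by case: l => //= l; case: insub => // i; exact: bond_gt0.
  by rewrite pnatr_eq0 -lt0n lcmn_gt0 !ext_gt0.
apply: (mulfI bond_lcm_neq0).
rewrite -(truncnK (LSpath_nat k Pa)) -(truncnK (LSpath_nat k Pa')).
by have := congr1 (fun m : 'X_{1..n.+1} => m k) eq_mnm; rewrite !mnmE => ->.
Qed.

Definition Emnm p k : 'X_{1..n.+1} :=
  [multinom if unlift ord_max j is Some i then absz (p 0%R i) else k | j < n.+1].

Lemma EmonomialE p k : Emonomial R p k = 'X_[Emnm p k].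
Proof.
rewrite mpolyXE_id big_ord_recr /= mnmE unlift_none; congr (_ * _).
apply: eq_bigr => i _.
have -> : widen_ord (leqnSn n) i = lift ord_max i.
  by apply/val_inj; exact/esym/lift_max.
by rewrite mnmE liftK.
Qed.

(** Points of a dilate have non-negative coordinates, so [absz] loses nothing. *)
Lemma Emnm_inj p q k h : in_dilate R b k p -> in_dilate R b h q ->
  Emnm p k = Emnm q h -> p = q /\ k = h.
Proof.
move=> Pp Pq eq_mnm.
have E j := congr1 (fun m : 'X_{1..n.+1} => m j) eq_mnm; split.
  apply/rowP => i; have := E (lift ord_max i); rewrite !mnmE liftK.
  by move=> /(congr1 Posz); rewrite !gez0_abs ?(in_dilate_ge0 i Pp)
    ?(in_dilate_ge0 i Pq).
by have := E ord_max; rewrite !mnmE unlift_none.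
Qed.

End PartialSums.

(** * Linear maps extending the correspondence and its inverse *)

Section Isomorphism.
Variables (R : realType) (n : nat) (b : bonds n).

(** Well defined, since the exponent vector determines [a], which determines [(p, k)]. *)
Lemma LSmonomial_to_Emonomial :
  exists F : {linear {mpoly R[i][n.+1]} -> {mpoly R[i][n.+1]}},
    forall a p k, LS_lecture_hall b a p k ->
    F (LSmonomial b a) = Emonomial R p k.
Proof.
pose P (m : 'X_{1..n.+1}) (u : {mpoly R[i][n.+1]}) :=
    exists (a : 'rV[R]_n.+1) p k,
  [/\ LS_lecture_hall b a p k, m = LSmnm b a & u = Emonomial R p k].
have [m u v [a [p [k [C -> ->]]]] [a' [q [h [C' Em ->]]]]|F FP] :=
    @mpoly_linear_relation R[i] n.+1 {mpoly R[i][n.+1]} P.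
  have [[Pa _ _ _] [Pa' _ _ _]] := (C, C').
  rewrite -(LSmnm_inj Pa Pa' Em) in C'.
  by have [-> ->] := LS_lecture_hall_functional C C'.
by exists F => a p k C; rewrite LSmonomialE; apply: FP; exists a, p, k.
Qed.

(** Well defined, since the exponent vector determines [(p, k)], which determines [a]. *)
Lemma Emonomial_to_LSmonomial :
  exists F : {linear {mpoly R[i][n.+1]} -> {mpoly R[i][n.+1]}},
    forall a p k, LS_lecture_hall b a p k ->
    F (Emonomial R p k) = LSmonomial b a.
Proof.
pose P (m : 'X_{1..n.+1}) (u : {mpoly R[i][n.+1]}) :=
    exists (a : 'rV[R]_n.+1) p k,
  [/\ LS_lecture_hall b a p k, m = Emnm p k & u = LSmonomial b a].
have [m u v [a [p [k [C -> ->]]]] [a' [q [h [C' Em ->]]]]|F FP] :=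
    @mpoly_linear_relation R[i] n.+1 {mpoly R[i][n.+1]} P.
  have [[_ Pp _ _] [_ Pq _ _]] := (C, C').
  have [eq_pq eq_kh] := Emnm_inj Pp Pq Em.
  by rewrite -eq_pq -eq_kh in C'; rewrite (LS_lecture_hall_inj C C').
by exists F => a p k C; rewrite EmonomialE; apply: FP; exists a, p, k.
Qed.

(** Membership is a span condition in the ambient polynomial ring. Lifting the monomials moves it
    into [LSalg], where linear maps defined only there can be compared. *)
Lemma LSalg_lspan (x : LSalg R b) :
  lspan (fun y => exists a (Pa : is_LSpath b a), y = LSalg_mon Pa) x.
Proof.
have [m [c [u [Pu xE]]]] := asboolP _ (LSalg_valP x).
have Qu i : exists y : LSalg R b, LSalg_val y = u i /\
    exists a (Pa : is_LSpath b a), y = LSalg_mon Pa.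
  by have [a Pa ->] := Pu i; exists (LSalg_mon Pa); split=> //; exists a, Pa.
have [y Py] := choice Qu; exists m, c, y; split=> [i|]; first by case: (Py i).
apply: val_inj; rewrite [LHS]xE linear_sum; apply: eq_bigr => i _.
by rewrite linearZ /=; case: (Py i) => ->.
Qed.

End Isomorphism.

(** * Restriction to the semigroup algebra and the Ehrhart ring *)

Theorem proposition4p4 (R : realType) (n : nat) (hn : (0 < n)%N)
    (b : bonds n) :
  exists f : {linear LSalg R b -> Ehrhart R b},
    [/\ extends_phi f,
        (forall g : {linear LSalg R b -> Ehrhart R b},
           extends_phi g -> forall x, g x = f x)
      & graded_alg_iso f].
Proof.
have [F FE] := LSmonomial_to_Emonomial R b.
have [G GE] := Emonomial_to_LSmonomial R b.
(* [F] and [G] live on the whole polynomial ring; they exchange the two spans and are mutually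
   inverse there. *)
have F_span p : lspan (@LSmonomials R n b) p -> lspan (@Emonomials R n b) (F p).
  apply: lspan_map => _ [a Pa ->]; have [q [k C]] := LSpath_lecture_hall Pa.
  by exists q, k; rewrite (FE _ _ _ C); case: C.
have G_span p : lspan (@Emonomials R n b) p -> lspan (@LSmonomials R n b) (G p).
  apply: lspan_map => _ [q [k [Pq ->]]]; have [a C] := lecture_hall_LSpath Pq.
  by exists a; rewrite ?(GE _ _ _ C) //; case: C.
have FK p : lspan (@LSmonomials R n b) p -> G (F p) = p.
  apply: (@eq_linear_lspan _ _ _ (G \o F) idfun) => _ [a Pa ->] /=.
  by have [q [k C]] := LSpath_lecture_hall Pa; rewrite (FE _ _ _ C) (GE _ _ _ C).
have GK p : lspan (@Emonomials R n b) p -> F (G p) = p.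
  apply: (@eq_linear_lspan _ _ _ (F \o G) idfun) => _ [q [k [Pq ->]]] /=.
  by have [a C] := lecture_hall_LSpath Pq; rewrite (GE _ _ _ C) (FE _ _ _ C).
have F_in (x : LSalg R b) : F (LSalg_val x) \in Ehrhart_pred b.
  by apply/asboolP/F_span/asboolP/LSalg_valP.
have G_in (y : Ehrhart R b) : G (Ehrhart_val y) \in LSalg_pred b.
  by apply/asboolP/G_span/asboolP/Ehrhart_valP.
pose f0 x := MkEhrhart (F_in x).
have f0_linear : linear f0.
  by move=> c x y; apply: val_inj; rewrite /= !linearP.
pose f : {linear LSalg R b -> Ehrhart R b} :=
  HB.pack f0 (GRing.isLinear.Build R[i] (LSalg R b) (Ehrhart R b) *:%R f0
    f0_linear).
have valf x : Ehrhart_val (f x) = F (LSalg_val x) by [].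
have f_mon a (Pa : is_LSpath b a) p k (Pp : in_dilate R b k p) :
    LS_lecture_hall b a p k -> f (LSalg_mon Pa) = Ehrhart_mon Pp.
  by move=> C; apply: val_inj; rewrite /= (FE _ _ _ C).
have f_phi : extends_phi f.
  move=> a Pa; have [p [k C]] := LSpath_lecture_hall Pa.
  by have [_ Pp phi_a deg_a] := C; exists p, k, Pp; split=> //; exact: f_mon.
exists f; split=> // [g g_phi x|].
  apply: eq_linear_lspan (LSalg_lspan x) => _ [a [Pa ->]].
  have [p [k [Pp [phi_a deg_a ->]]]] := g_phi a Pa.
  by apply/esym/f_mon.
split.
- split=> [|x y]; apply: val_inj.
    (* The unit is the monomial of the zero path. *)
    have := FE _ _ _ (LS_lecture_hall0 R b).
    by rewrite LSmonomial0 Emonomial0.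
  rewrite /=.
  (* Bilinearity reduces multiplicativity to two monomials, where it is additivity of the
     correspondence. *)
  have [m [c [u [Pu ->]]]] := asboolP _ (LSalg_valP x).
  have [m' [c' [u' [Pu' ->]]]] := asboolP _ (LSalg_valP y).
  rewrite !linear_sum !mulr_suml linear_sum; apply: eq_bigr => i _.
  rewrite !mulr_sumr linear_sum; apply: eq_bigr => j _.
  rewrite !linearZ -!scalerAl -!scalerAr !linearZ /=.
  rewrite [RHS]scalerA [c' j * _]mulrC -scalerA; do 2!congr (_ *: _).
  have [[a Pa ->] [a' Pa' ->]] := (Pu i, Pu' j).
  have [p [k C]] := LSpath_lecture_hall Pa.
  have [q [h C']] := LSpath_lecture_hall Pa'.
  rewrite -LSmonomialD // (FE _ _ _ (LS_lecture_hallD C C')) (FE _ _ _ C) (FE _ _ _ C').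
  by have [[_ Pp _ _] [_ Pq _ _]] := (C, C'); rewrite (EmonomialD Pp Pq).
- exists (fun y => LSAlg (G_in y)) => [x|y]; apply: val_inj => /=.
    by apply/FK/asboolP/LSalg_valP.
  by apply/GK/asboolP/Ehrhart_valP.
- move=> k x; split; rewrite /Ehrhart_homog /LSalg_homog valf.
    apply: lspan_map => _ [a [Pa deg_a ->]].
    have [p [h C]] := LSpath_lecture_hall Pa.
    have [_ Pp _ deg_h] := C.
    have /eqP := etrans (esym deg_a) deg_h; rewrite eqr_nat => /eqP kh.
    by exists p; rewrite ?(FE _ _ _ C) kh.
  (* Writing [x] as [G (F x)] reduces the converse to [G] respecting degrees on monomials. *)
  rewrite -{2}(FK (LSalg_val x)); last by apply/asboolP/LSalg_valP.
  apply: lspan_map => _ [p Pp ->]; have [a C] := lecture_hall_LSpath Pp.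
  by exists a; rewrite (GE _ _ _ C); case: C.
Qed.
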